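(* For $A,B,g\in\mathbb Z_{\ge0}$, the $(1,3)$ entry of the matrix of the move $V(A,B,g)$ is $gB-A$. Hence, whenever $gB>A$, the head transform $$u_1'=u_1-gu_2+(gB-A)u_3$$ adds a positive multiple of $u_3$. This transform is available inside the window, as the composition of first reducing $u_2$ by $Bu_3$ and then subtracting $g$ copies of the result from the head (together with $A$ copies of $u_3$).
   Context: $K$ is a cubic number field of signature $(1,1)$ with real embedding $\sigma_r$. A state is an ordered triple $(u_1,u_2,u_3)$ of elements of an order $L\subset\mathcal O_K$ forming a $\mathbb Q$-basis of $K$ with $x_i=\sigma_r(u_i)>0$, sorted so that $x_1\ge x_2\ge x_3>0$; the head is $u_1$. The move $V(A,B,g)$ ($A,B,g\in\mathbb Z_{\ge0}$) sends the column vector $(u_1,u_2,u_3)$ to $(u_1-g(u_2-Bu_3)-Au_3,\ u_2-Bu_3,\ u_3)$; equivalently its matrix is the inverse of $\begin{pmatrix}1&g&A\\0&1&B\\0&0&1\end{pmatrix}$. The window at a state is the set of moves for which all new real coordinates are positive. *)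

(* Defs.v *)
From HB Require Import structures.
From mathcomp Require Export all_boot all_order all_algebra all_field.
From mathcomp Require Export reals.
From mathcomp Require Export complex.

Set Implicit Arguments.
Unset Strict Implicit.
Unset Printing Implicit Defensive.

Import Order.TTheory GRing.Theory Num.Theory.

Local Open Scope ring_scope.

(* [rho] lists the real embeddings of K without repetition; [tau] lists the
   non-real complex embeddings, one per pair {tau, conjugate of tau}. *)
Definition has_signature (R : realType) (K : fieldExtType rat) (r1 r2 : nat) :=
  exists (rho : 'I_r1 -> {rmorphism K -> R})
         (tau : 'I_r2 -> {rmorphism K -> R[i]}),
    [/\ forall i j, rho i =1 rho j -> i = j,
        forall s : {rmorphism K -> R}, exists i, s =1 rho i,
        forall i, exists x, complex.Im (tau i x) != 0,
        forall i j, tau i =1 tau j \/ tau i =1 conjc \o tau j -> i = j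
      & forall t : {rmorphism K -> R[i]},
          (exists x, complex.Im (t x) != 0) ->
          exists i, t =1 tau i \/ t =1 conjc \o tau i].

Definition algebraic_integer (K : fieldExtType rat) (x : K) :=
  integralOver (intr : int -> K) x.

(* A subring whose underlying group is the Z-span of some Q-basis of K. *)
Definition is_order (K : fieldExtType rat) (L : {pred K}) :=
  subring_closed L /\
  exists b : (\dim {:K}).-tuple K,
    basis_of {:K} b /\ forall x, x \in L <-> inIntSpan b x.

(* Triples are column vectors; the indices 0, 1, 2 : 'I_3 carry the
   coordinates u_1, u_2, u_3. *)
Definition triple (K : Type) (a b c : K) : 'cV[K]_3 :=
  \col_(i < 3) tnth [tuple a; b; c] i.

Definition is_state (R : realType) (K : fieldExtType rat)
    (sigma : {rmorphism K -> R}) (L : {pred K}) (u : 'cV[K]_3) :=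
  [/\ forall i, u i 0 \in L,
      basis_of {:K} [:: u 0 0; u 1 0; u 2 0],
      forall i, 0 < sigma (u i 0),
      sigma (u 1 0) <= sigma (u 0 0)
    & sigma (u 2 0) <= sigma (u 1 0)].

Definition state_head (K : Type) (u : 'cV[K]_3) : K := u 0 0.

Definition move (K : fieldExtType rat) (A B g : nat) (u : 'cV[K]_3) :
    'cV[K]_3 :=
  let v2 := u 1 0 - u 2 0 *+ B in
  triple (u 0 0 - v2 *+ g - u 2 0 *+ A) v2 (u 2 0).

Definition move_mx (A B g : nat) : 'M[int]_3 :=
  invmx (\matrix_(i < 3, j < 3)
    tnth (tnth [tuple [tuple 1; g%:Z; A%:Z];
                      [tuple 0; 1;    B%:Z];
                      [tuple 0; 0;    1   ]] i) j).

(* Stated for arbitrary triples: after a move the coordinates need not be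
   sorted, so an intermediate triple of a composition need not be a state. *)
Definition in_window (R : realType) (K : fieldExtType rat)
    (sigma : {rmorphism K -> R}) (u : 'cV[K]_3) (A B g : nat) :=
  forall i, 0 < sigma (move A B g u i 0).

(* Main.v *)
Require Import Defs.
From mathcomp Require Import all_boot all_order all_algebra all_field.
From mathcomp Require Import reals complex.
From mathcomp Require Import ring lra.

Set Implicit Arguments.
Unset Strict Implicit.
Unset Printing Implicit Defensive.

Import Order.TTheory GRing.Theory Num.Theory.

Local Open Scope ring_scope.

(** The inverse of the unipotent matrix of parameters g, A, B is written down
    explicitly in [move_mxE] and checked by multiplication; its corner entry
    g B - A is the coefficient of u_3 in the head of the transformed triple.

    The window of V(A, B, g) splits along the composition V(0, B, 0) followed
    by V(A, 0, g) because the intermediate triple (u_1, u_2 - B u_3, u_3)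
    differs from the final one only in its head, and there it still carries the
    head u_1 of the state, which is positive.

    For availability at some state ([exists_state_window]), an order contains
    a basis w_1, w_2, w_3 of K; as an order contains the opposites of its
    elements, all w_i can be taken positive at the real embedding. Then
      u_3 = w_3,  u_2 = w_2 + (B + 1) w_3,  u_1 = w_1 + (g + 1) u_2 + A w_3
    is a basis of the same space, it is sorted, and subtracting from it what the
    move prescribes leaves sums of positive terms. For availability at a given
    state ([state_unit_window]), V(0, 1, 1) always works: it produces the
    coordinates x_1 - x_2 + x_3, x_2 - x_3 and x_3, and x_2 > x_3 strictly since
    the embedding is injective and u_2, u_3 are independent. *)

Lemma ord3P (P : 'I_3 -> Prop) : P 0 -> P 1 -> P 2 -> forall i, P i.
Proof.
move=> P0 P1 P2 [[|[|[|//]]] lt_i3].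
- by rewrite (_ : Ordinal _ = 0) //; apply: val_inj.
- by rewrite (_ : Ordinal _ = 1) //; apply: val_inj.
- by rewrite (_ : Ordinal _ = 2) //; apply: val_inj.
Qed.

Lemma cV3P (K : Type) (u v : 'cV[K]_3) :
  u 0 0 = v 0 0 -> u 1 0 = v 1 0 -> u 2 0 = v 2 0 -> u = v.
Proof.
move=> e0 e1 e2; apply/matrixP=> i j; rewrite (ord1 j).
by elim/ord3P: i.
Qed.

Lemma sum3 (V : zmodType) (F : 'I_3 -> V) :
  \sum_(i < 3) F i = F 0 + F 1 + F 2.
Proof.
rewrite !big_ord_recl big_ord0 addr0 addrA.
by congr (_ + F _ + F _); apply: val_inj.
Qed.

Lemma triple0 (K : Type) (a b c : K) : triple a b c 0 0 = a.
Proof. by rewrite mxE. Qed.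

Lemma triple1 (K : Type) (a b c : K) : triple a b c 1 0 = b.
Proof. by rewrite mxE. Qed.

Lemma triple2 (K : Type) (a b c : K) : triple a b c 2 0 = c.
Proof. by rewrite mxE. Qed.

Definition tripleE := (triple0, triple1, triple2).

Lemma move_mxE A B g : move_mx A B g = \matrix_(i < 3, j < 3)
    tnth (tnth [tuple [tuple 1; - g%:Z; (g * B)%:Z - A%:Z];
                      [tuple 0; 1;      - B%:Z];
                      [tuple 0; 0;      1     ]] i) j.
Proof.
rewrite /move_mx; set U := (X in invmx X); set V := (RHS).
have UV : U *m V = 1%:M.
  apply/matrixP => i j; rewrite !mxE sum3 !mxE.
  by elim/ord3P: i; elim/ord3P: j; rewrite /tnth /= ?PoszM; ring.
have [U_unit _] := mulmx1_unit UV.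
by rewrite -[V](mulKmx U_unit) UV mulmx1.
Qed.

Lemma move_mxP (K : fieldExtType rat) A B g (u : 'cV[K]_3) :
  move A B g u = map_mx intr (move_mx A B g) *m u.
Proof.
have rowE i : (map_mx intr (move_mx A B g) *m u) i 0 =
    (move_mx A B g i 0)%:~R * u 0 0 + (move_mx A B g i 1)%:~R * u 1 0
      + (move_mx A B g i 2)%:~R * u 2 0.
  by rewrite mxE sum3 !(mxE _ _ i).
apply: cV3P; rewrite tripleE rowE move_mxE !mxE /tnth /=.
- rewrite rmorphN rmorphB /= PoszM rmorphM /= -!pmulrn.
  rewrite -!(mulr_natl (_ - _)) -!(mulr_natl (u 2 0)).
  move: (u 0 0) (u 1 0) (u 2 0) => x y z; ring.
- rewrite rmorphN /= -!pmulrn -(mulr_natl (u 2 0)).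
  move: (u 0 0) (u 1 0) (u 2 0) => x y z; ring.
- by rewrite !mul0r mul1r !add0r.
Qed.

(** Membership in the window as linear inequalities over the reals, the form in
    which the arithmetic decision procedures can use it. *)
Lemma in_windowP (R : realType) (K : fieldExtType rat)
    (sigma : {rmorphism K -> R}) (u : 'cV[K]_3) A B g :
  in_window sigma u A B g <->
  [/\ 0 < sigma (u 0 0) - (sigma (u 1 0) - B%:R * sigma (u 2 0)) * g%:R
          - A%:R * sigma (u 2 0),
      0 < sigma (u 1 0) - B%:R * sigma (u 2 0) & 0 < sigma (u 2 0)].
Proof.
have E0 : sigma (move A B g u 0 0) =
   sigma (u 0 0) - (sigma (u 1 0) - B%:R * sigma (u 2 0)) * g%:R
          - A%:R * sigma (u 2 0).
  rewrite tripleE !(rmorphB, rmorphMn) /=.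
  by rewrite -!(mulr_natl (sigma (u 2 0))) mulr_natr.
have E1 : sigma (move A B g u 1 0) = sigma (u 1 0) - B%:R * sigma (u 2 0).
  by rewrite tripleE rmorphB rmorphMn mulr_natl.
have E2 : sigma (move A B g u 2 0) = sigma (u 2 0) by rewrite tripleE.
rewrite -E0 -E1 -E2; split=> [w | [w0 w1 w2]]; first by split.
by elim/ord3P.
Qed.

Lemma move_comp (K : fieldExtType rat) A B g (u : 'cV[K]_3) :
  move A B g u = move A 0 g (move 0 B 0 u).
Proof. by apply: cV3P; rewrite !tripleE ?mulr0n ?subr0. Qed.

Lemma head_moveE (K : fieldExtType rat) A B g (u : 'cV[K]_3) :
  state_head (move A B g u)
    = u 0 0 - u 1 0 *+ g + u 2 0 *~ ((g * B)%:Z - A%:Z).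
Proof.
rewrite /state_head tripleE mulrzBr -!pmulrn.
by move: (u 0 0) (u 1 0) (u 2 0) => x y z; ring.
Qed.

(** The final triple is the same on both sides, so all that the right-hand side
    adds is the intermediate triple. Its head is u_1, whence the hypothesis; its
    other two coordinates are those of the final triple. *)
Lemma window_comp (R : realType) (K : fieldExtType rat)
    (sigma : {rmorphism K -> R}) (u : 'cV[K]_3) A B g :
  0 < sigma (u 0 0) ->
  in_window sigma u A B g <->
  in_window sigma u 0 B 0 /\ in_window sigma (move 0 B 0 u) A 0 g.
Proof.
move=> x1_gt0; split=> [w | [_ w] i]; last by rewrite move_comp; apply: w.
split; last by move=> i; rewrite -move_comp; apply: w.
by case/in_windowP: w => _ v2_gt0 x3_gt0; apply/in_windowP; split=> //; lra.
Qed.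

(** A spanning family with no more members than a basis is a basis, so changing
    basis only requires solving for the old vectors in terms of the new ones. *)
Lemma basis_of_spanning (F : fieldType) (vT : vectType F) (U : {vspace vT})
    (X Y : seq vT) :
  basis_of U X -> (size Y <= size X)%N -> {subset X <= <<Y>>%VS} ->
  basis_of U Y.
Proof.
move=> bX sYX XY; rewrite basisEdim; apply/andP; split.
  by rewrite -(span_basis bX); apply/span_subvP.
by rewrite (size_basis (X := in_tuple X) bX) in sYX *.
Qed.

(** Each vector of an integral basis is its own integral combination, with the
    indicator of its index as coefficients. *)
Lemma order_mem_basis (K : fieldExtType rat) (L : {pred K}) : is_order L ->
  exists2 b : seq K, basis_of {:K} b & {subset b <= L}.
Proof.
case=> _ [b [bK bL]]; exists b => // x /tnthP [i ->]; apply/bL.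
exists [ffun j => (j == i)%:Z].
rewrite (bigD1 i) //= ffunE eqxx big1 ?addr0 ?(tnth_nth 0) //.
by move=> j /negPf ne; rewrite ffunE ne.
Qed.

(** Changing the sign of basis vectors keeps a basis, and an order is stable
    under opposites; no basis vector vanishes under the injective [sigma]. *)
Lemma order_pos_basis (R : realType) (K : fieldExtType rat)
    (sigma : {rmorphism K -> R}) (L : {pred K}) : is_order L ->
  exists2 b : seq K, basis_of {:K} b &
    {in b, forall x, x \in L /\ 0 < sigma x}.
Proof.
move=> oL; have [b bK bL] := order_mem_basis oL.
have [[L1 LB _] _] := oL.
have LN x : x \in L -> - x \in L.
  by move=> Lx; rewrite -sub0r LB // -(subrr 1) LB.
pose s x := if sigma x < 0 then - x else x.
exists (map s b).
  apply: (basis_of_spanning bK); first by rewrite size_map.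
  move=> x xb.
  have : s x \in <<map s b>>%VS by rewrite memv_span ?map_f.
  by rewrite /s; case: ifP; rewrite ?rpredN.
move=> _ /mapP [x xb ->].
have x0 : sigma x != 0.
  by rewrite fmorph_eq0 (free_not0 (basis_free bK)).
have Lx := bL x xb.
rewrite /s; case: ifPn => [x_lt0 | x_ge0]; split=> //.
- exact: LN.
- by rewrite rmorphN oppr_gt0.
- by rewrite lt0r x0 leNgt.
Qed.

(** The triple adds to a positive basis of the order just the multiples that the
    move takes away: it ends at u_2' = w_2 + w_3 and
    u_1' = w_1 + u_2 + g B w_3, both sums of positive terms. *)
Lemma exists_state_window (R : realType) (K : fieldExtType rat)
    (sigma : {rmorphism K -> R}) (L : {pred K}) A B g :
  \dim {:K} = 3%N -> is_order L ->
  exists u, is_state sigma L u /\ in_window sigma u A B g.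
Proof.
move=> hdim oL; have [b bK bL] := order_pos_basis sigma oL.
have sz : size b = 3%N by rewrite -hdim (size_basis (X := in_tuple b) bK).
case: b sz bK bL => [//|w1 [//|w2 [//|w3 [|//]]]] _ bK bL.
have [Lw1 w1_gt0] : w1 \in L /\ 0 < sigma w1 by apply: bL; rewrite !inE eqxx.
have [Lw2 w2_gt0] : w2 \in L /\ 0 < sigma w2.
  by apply: bL; rewrite !inE eqxx orbT.
have [Lw3 w3_gt0] : w3 \in L /\ 0 < sigma w3.
  by apply: bL; rewrite !inE eqxx !orbT.
have [[L1 LB _] _] := oL.
have L0 : 0 \in L by rewrite -(subrr 1) LB.
have LD x y : x \in L -> y \in L -> x + y \in L.
  by move=> Lx Ly; rewrite -[y]opprK LB // -sub0r LB.
have LMn x n : x \in L -> x *+ n \in L.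
  by move=> Lx; elim: n => [|n IH]; rewrite ?mulr0n // mulrS LD.
pose u2 := w2 + w3 *+ B.+1.
have u2_gt0 : 0 < sigma u2 by rewrite rmorphD rmorphMn addr_gt0 ?mulrn_wgt0.
pose u1 := w1 + u2 *+ g.+1 + w3 *+ A.
exists (triple u1 u2 w3).
have x2E : sigma u2 = sigma w2 + (B%:R + 1) * sigma w3.
  by rewrite rmorphD rmorphMn /= natr1 mulr_natl.
have x1E : sigma u1 = sigma w1 + (g%:R + 1) * sigma u2 + A%:R * sigma w3.
  by rewrite !(rmorphD, rmorphMn) natr1 !mulr_natl.
have pos n x : 0 < x -> 0 <= n%:R * x :> R by move=> /ltW; apply: mulr_ge0.
have gu := pos g _ u2_gt0.
have [Aw Bw] := (pos A _ w3_gt0, pos B _ w3_gt0).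
have gBw : 0 <= g%:R * (B%:R * sigma w3) by rewrite mulr_ge0.
split; last first.
  by apply/in_windowP; rewrite !tripleE; split=> //; nra.
split; rewrite ?tripleE.
- by elim/ord3P; rewrite tripleE // !(LD, LMn).
- apply: (basis_of_spanning bK) => // x.
  set S := <<_>>%VS.
  have S1 : u1 \in S by rewrite memv_span // !inE eqxx.
  have S2 : u2 \in S by rewrite memv_span // !inE eqxx orbT.
  have S3 : w3 \in S by rewrite memv_span // !inE eqxx !orbT.
  rewrite !inE => /or3P [] /eqP -> //.
    rewrite (_ : w1 = u1 - u2 *+ g.+1 - w3 *+ A) ?rpredB ?rpredMn //.
    by rewrite /u1; ring.
  rewrite (_ : w2 = u2 - w3 *+ B.+1) ?rpredB ?rpredMn //.
  by rewrite /u2; ring.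
- by elim/ord3P; rewrite tripleE // x1E; nra.
- by rewrite x1E; lra.
- by rewrite x2E; lra.
Qed.

(** The new head x_1 - x_2 + x_3 is positive because x_1 >= x_2; the second
    coordinate x_2 - x_3 would vanish if x_2 = x_3, but then u_2 = u_3. *)
Lemma state_unit_window (R : realType) (K : fieldExtType rat)
    (sigma : {rmorphism K -> R}) (L : {pred K}) (u : 'cV[K]_3) :
  is_state sigma L u -> in_window sigma u 0 1 1.
Proof.
case=> _ /basis_free/free_uniq /= u_uniq pos x12 x23.
have u12 : u 1 0 != u 2 0 by move: u_uniq; rewrite !inE => /and3P [].
have x3_lt : sigma (u 2 0) < sigma (u 1 0).
  by rewrite lt_neqAle x23 andbT fmorph_eq eq_sym.
have [x1_gt0 x3_gt0] := (pos 0, pos 2).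
by apply/in_windowP; split=> //; lra.
Qed.

Theorem proposition6p4 (R : realType) (K : fieldExtType rat)
    (hdim : \dim {:K} = 3%N) (hsig : has_signature R K 1 1)
    (sigma_r : {rmorphism K -> R}) (L : {pred K}) (hL : is_order L)
    (hLO : forall x, x \in L -> algebraic_integer x) :
  [/\ (* the matrix of the move and its (1,3) entry *)
      forall A B g : nat,
        (forall u : 'cV[K]_3, move A B g u = map_mx intr (move_mx A B g) *m u)
        /\ move_mx A B g 0 2 = (g * B)%:Z - A%:Z,
      (* the head transform, and its realisation as a composition of moves
         in the window *)
      forall A B g : nat, (A < g * B)%N ->
        0 < (g * B)%:Z - A%:Z
        /\ (forall u : 'cV[K]_3, is_state sigma_r L u ->
             [/\ state_head (move A B g u)
                   = u 0 0 - u 1 0 *+ g + u 2 0 *~ ((g * B)%:Z - A%:Z),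
                 move A B g u = move A 0 g (move 0 B 0 u)
               & in_window sigma_r u A B g
                 <-> in_window sigma_r u 0 B 0
                     /\ in_window sigma_r (move 0 B 0 u) A 0 g]),
      (* availability: every such transform lies in the window of some state *)
      forall A B g : nat, (A < g * B)%N ->
        exists u : 'cV[K]_3, is_state sigma_r L u /\ in_window sigma_r u A B g
    & (* availability: every state has such a transform in its window *)
      forall u : 'cV[K]_3, is_state sigma_r L u ->
        exists A B g : nat, (A < g * B)%N /\ in_window sigma_r u A B g].
Proof.
split.
- by move=> A B g; split; [exact: move_mxP | rewrite move_mxE mxE].
- move=> A B g ltA; split; first by rewrite subr_gt0 ltz_nat.
  move=> u [_ _ pos _ _].
  by split; [exact: head_moveE | exact: move_comp | exact: window_comp].
- by move=> A B g _; apply: exists_state_window.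
- by move=> u st; exists 0%N, 1%N, 1%N; split=> //; apply: state_unit_window st.
Qed.
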